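(* Let $E$ be a Fréchet space. Then $(E,w)$ is linearly Eberlein-Grothendieck if and only if the metric of $E$ can be generated by a complete norm, i.e. $E$ is isomorphic to a Banach space.
   Context: All vector spaces are over $\mathbb{R}$. A Fréchet space is a completely metrizable locally convex space; isomorphic means linearly homeomorphic. For a locally convex space $E$, $(E,w)$ denotes $E$ with its weak topology $w=\sigma(E,E^{\ast})$, where $E^{\ast}$ is the space of continuous linear functionals on $E$. $C_p(K)$ is the space of continuous real-valued functions on $K$ with the topology of pointwise convergence. A locally convex space $H$ is linearly Eberlein-Grothendieck if $H$ is linearly isomorphic (i.e. linearly homeomorphic) to a linear subspace of $C_p(K)$ for some compact (Hausdorff) space $K$. *)

(* Defs.v *)
From HB Require Import structures.
From mathcomp Require Import all_boot all_order all_algebra.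
From mathcomp Require Import all_classical all_reals all_analysis.

Set Implicit Arguments.
Unset Strict Implicit.
Unset Printing Implicit Defensive.

Import Order.TTheory GRing.Theory Num.Theory.
Import numFieldNormedType.Exports.

Local Open Scope classical_set_scope.
Local Open Scope ring_scope.

(* Only the topology of [T] is compared with that of the metric structure [m]:
   [T] may carry an unrelated uniform structure, and when [T] is a vector space
   the metric need not be translation invariant. *)
Definition completely_metrizable (R : realType) (T : topologicalType) : Prop :=
  exists m : Metric R T,
    let M : metricType R := Metric.Pack m in
    (forall x : T, @nbhs T T x = @nbhs M M x) /\
    (forall F : set_system M, ProperFilter F -> cauchy F -> exists x : M, F --> x).

Section LocallyConvexSpaces.
Context {R : realType}.

Definition frechet_space (E : tvsType R) : Prop := completely_metrizable R E.

(* [f] is a linear homeomorphism of [V] onto [A], where [A] carries the topology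
   induced by [W]; the values of [g] outside [A] are irrelevant. *)
Definition linear_homeomorphism_onto (V W : preTopologicalLmodType R)
    (A : set W) (f : {linear V -> W}) : Prop :=
  [/\ set_bij [set: V] A f, continuous f &
      exists2 g : W -> V, cancel f g & {within A, continuous g}].

Definition isomorphic (V W : preTopologicalLmodType R) : Prop :=
  exists f : {linear V -> W}, linear_homeomorphism_onto [set: W] f.

Definition norm_ball (E : lmodType R) (N : E -> R) (x : E) (e : R) : set E :=
  [set y | N (x - y) < e].

Definition generated_by_complete_norm (E : tvsType R) : Prop :=
  exists N : E -> R,
    [/\ forall x, N x = 0 -> x = 0,
        forall x y, N (x + y) <= N x + N y,
        forall a x, N (a *: x) = `|a| * N x,
        forall x : E, nbhs x = nbhs_ball_ (norm_ball N) x &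
        forall F : set_system E, ProperFilter F ->
          (forall e, 0 < e -> exists x, F (norm_ball N x e)) ->
          exists x : E, F --> x].

Definition dual (E : tvsType R) : Type :=
  {phi : {linear E -> R^o} | continuous phi}.

Definition weak (E : tvsType R) : Type := E.

HB.instance Definition _ (E : tvsType R) := GRing.Lmodule.on (weak E).

(* The coarsest topology making every element of the dual continuous. *)
HB.instance Definition _ (E : tvsType R) := Topological.copy (weak E)
  (sup_topology (fun phi : dual E =>
     Topological.on (initial_topology (sval phi : E -> R^o)))).

End LocallyConvexSpaces.

Section PointwiseConvergence.
Context (R : realType) (K : topologicalType).

HB.instance Definition _ := GRing.Lmodule.copy {ptws K -> R^o} (K -> R^o).

Definition continuous_fun : {pred {ptws K -> R^o}} :=
  fun f => `[< continuous (f : K -> R^o) >].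

Lemma continuous_fun_submod_closed : submod_closed continuous_fun.
Proof.
split=> [|a f g]; rewrite !unfold_in; first exact/asboolP/cst_continuous.
move=> /asboolP cf /asboolP cg; apply/asboolP => x.
apply: (@continuousD _ R^o) (cg x).
by apply: (@continuousZr _ R^o); exact: cf.
Qed.

HB.instance Definition _ := GRing.isSubmodClosed.Build R {ptws K -> R^o}
  continuous_fun continuous_fun_submod_closed.

Definition Cp : Type := {f : {ptws K -> R^o} | f \in continuous_fun}.

HB.instance Definition _ := SubChoice.on Cp.
HB.instance Definition _ := [SubChoice_isSubLmodule of Cp by <:].
HB.instance Definition _ := Topological.copy Cp
  (initial_topology (\val : Cp -> {ptws K -> R^o})).

End PointwiseConvergence.

Definition linearly_Eberlein_Grothendieck (R : realType)
    (H : preTopologicalLmodType R) : Prop :=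
  exists K : topologicalType, [/\ compact [set: K], hausdorff_space K &
    exists A : set (Cp R K), submod_closed [in A] /\
      exists f : {linear H -> Cp R K}, linear_homeomorphism_onto A f].

(* Main.v *)
Require Import Defs.
From HB Require Import structures.
From mathcomp Require Import all_boot all_order all_algebra.
From mathcomp Require Import all_classical all_reals all_analysis.
From mathcomp Require Import ring lra.

Set Implicit Arguments.
Unset Strict Implicit.
Unset Printing Implicit Defensive.

Import Order.TTheory GRing.Theory Num.Theory.
Import numFieldNormedType.Exports.

Local Open Scope classical_set_scope.
Local Open Scope ring_scope.

(** Suppose first that [f] embeds the weak space of [E] linearly in [C_p(K)]
    with [K] compact. The supremum norm of [K] pulls back to a norm
    [p x = sup_k |f x k|] on [E], and [p] turns out to be a complete norm that
    generates the topology. Three facts are needed.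

    The topology of [E] is finer than that of [p]. Each [x |-> f x k] is
    continuous, so the unit ball of [p] is closed; as [E] is a Baire space
    ([baire]), this ball is a neighbourhood of [0]
    ([closed_seminorm_continuous]).

    The topology of [p] is finer than that of [E]. Every functional in the dual
    of [E] is bounded on the unit ball of [p], because it factors through [f]
    and a neighbourhood of [0] in [C_p(K)] contains a multiple of the uniform
    unit ball ([Cp_nbhs0_unorm]). A weakly bounded set is bounded
    ([uniform_boundedness], applied to the gauges of the convex neighbourhoods
    of [0]), so each neighbourhood of [0] absorbs the ball.

    Finally [p] is complete. The complete metric of [E] is not assumed to be
    translation invariant, so its Cauchy sequences say nothing about those of
    [p]; that a completely metrizable normed space is nonetheless complete is a
    theorem of Klee ([completely_metrizable_norm_complete]).

    Conversely, if a norm generates the topology of [E], its dual unit ball,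
    with pointwise convergence, is compact by Tychonoff, and evaluation embeds
    the weak space of [E] in the continuous functions on that ball: it is
    injective by the Hahn-Banach theorem, and its inverse is weakly continuous
    because every functional is a multiple of a point of the ball
    ([normed_EG]).

    The equivalence with being isomorphic to a Banach space only moves norms
    along linear homeomorphisms. *)

(** * Sublinear functionals and the Hahn-Banach theorem *)
Section Sublinear.
Context {R : realType} {X : lmodType R}.
Implicit Types (p q : X -> R) (x y : X).

(** Only the inequality is required for homogeneity: applying it to [a] and to
    [a^-1] gives equality, and leaving out [a = 0] spares a case each time a
    functional is built as an infimum. *)
Definition sublinear q :=
  (forall x y, q (x + y) <= q x + q y) /\
  (forall a x, 0 < a -> q (a *: x) <= a * q x).

Definition seminorm q :=
  (forall x y, q (x + y) <= q x + q y) /\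
  (forall a x, q (a *: x) = `|a| * q x).

Lemma sublinearZ q a x : sublinear q -> 0 < a -> q (a *: x) = a * q x.
Proof.
move=> [_ qZ] a0; apply/eqP; rewrite eq_le qZ//=.
have := qZ a^-1 (a *: x); rewrite invr_gt0 scalerA mulVf ?gt_eqF// scale1r.
by move=> /(_ a0); rewrite ler_pdivlMl.
Qed.

Lemma sublinear0 q : sublinear q -> q 0 = 0.
Proof. by move=> /(@sublinearZ q 2 0)/(_ ltac:(lra)); rewrite scaler0; lra. Qed.

Lemma sublinear_geN q x : sublinear q -> - q (- x) <= q x.
Proof.
move=> sq; have := sq.1 x (- x).
by rewrite subrr sublinear0// -lerBlDr sub0r.
Qed.

Lemma seminorm_sublinear q : seminorm q -> sublinear q.
Proof. by move=> [qD qZ]; split=> // a x a0; rewrite qZ gtr0_norm. Qed.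

Lemma seminormN q x : seminorm q -> q (- x) = q x.
Proof. by move=> [_ qZ]; rewrite -scaleN1r qZ normrN normr1 mul1r. Qed.

Lemma seminorm_ge0 q x : seminorm q -> 0 <= q x.
Proof.
move=> sq; have := sublinear_geN x (seminorm_sublinear sq).
by rewrite seminormN//; lra.
Qed.

Lemma seminormB q x y : seminorm q -> q (x - y) = q (y - x).
Proof. by move=> sq; rewrite -(seminormN _ sq) opprB. Qed.

Lemma seminorm_ler_norm q (phi : {linear X -> R^o}) x : seminorm q ->
  (forall x, phi x <= q x) -> `|phi x| <= q x.
Proof.
move=> sq le_phi_q; rewrite ler_norml le_phi_q andbT lerNl.
by rewrite -(seminormN _ sq) -linearN.
Qed.

(** Lowers [q] so that it becomes odd in the direction [y], while keeping it
    sublinear: [slide q y (- y) <= - q y] ([slideN]). *)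
Definition slide q y x := inf [set q (x + t *: y) - t * q y | t in [set t | 0 <= t]].

Lemma slide_lbound q x y : sublinear q ->
  has_lbound [set q (x + t *: y) - t * q y | t in [set t | 0 <= t]].
Proof.
move=> sq; exists (- q (- x)) => _ [t /= t0 <-].
have [<-|tN0] := eqVneq 0 t.
  by rewrite scale0r addr0 mul0r subr0 sublinear_geN.
have t_gt0 : 0 < t by rewrite lt_neqAle tN0.
have := sq.1 (- x) (x + t *: y).
by rewrite addrA addNr add0r (sublinearZ _ sq t_gt0); lra.
Qed.

Lemma slide_le q x y t : sublinear q -> 0 <= t ->
  slide q y x <= q (x + t *: y) - t * q y.
Proof. by move=> sq t0; apply: ge_inf; [exact: slide_lbound|exists t]. Qed.

Lemma slide_ge q x y c : (forall t, 0 <= t -> c <= q (x + t *: y) - t * q y) ->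
  c <= slide q y x.
Proof.
move=> le_c; apply: lb_le_inf; last by move=> _ [t /= /le_c ? <-].
by exists (q (x + 0 *: y) - 0 * q y), 0 => /=.
Qed.

Lemma slide_sublinear q y : sublinear q -> sublinear (slide q y).
Proof.
move=> sq; split=> [x x'|a x a0].
  rewrite -lerBlDr; apply: slide_ge => t t0.
  rewrite lerBlDl -lerBlDr; apply: slide_ge => s s0; rewrite lerBlDr.
  apply: le_trans (slide_le _ _ sq (addr_ge0 t0 s0)) _.
  have := sq.1 (x + t *: y) (x' + s *: y).
  by rewrite addrACA -scalerDl; lra.
rewrite -ler_pdivrMl//; apply: slide_ge => t t0; rewrite ler_pdivrMl//.
apply: le_trans (slide_le _ _ sq (mulr_ge0 (ltW a0) t0)) _.
by rewrite -scalerA -scalerDr (sublinearZ _ sq a0); lra.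
Qed.

Lemma slide_ler q x y : sublinear q -> slide q y x <= q x.
Proof.
move=> sq; apply: le_trans (slide_le x y sq (lexx 0)) _.
by rewrite scale0r addr0; lra.
Qed.

Lemma slideN q y : sublinear q -> slide q y (- y) <= - q y.
Proof.
move=> sq; apply: le_trans (slide_le _ _ sq ler01) _.
by rewrite scale1r addNr sublinear0//; lra.
Qed.

(** The chain condition is what makes the infimum subadditive: two members of
    the chain can be replaced by the smaller one. *)
Lemma chain_inf_sublinear q (A : set (X -> R)) : A !=set0 ->
  (forall p, A p -> sublinear p /\ forall x, p x <= q x) ->
  (forall p p', A p -> A p' -> (forall x, p x <= p' x) \/ (forall x, p' x <= p x)) ->
  exists m, [/\ sublinear m, forall x, m x <= q x &
    forall p x, A p -> m x <= p x].
Proof.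
move=> [p0 Ap0] Asub Achain.
pose m x := inf [set p x | p in A].
have m_le p x : A p -> m x <= p x.
  move=> Ap; apply: ge_inf; last by exists p.
  exists (- q (- x)) => _ [p' /Asub[sp' le_p'_q] <-].
  by apply: le_trans (sublinear_geN x sp'); rewrite lerN2.
have m_ge x c : (forall p, A p -> c <= p x) -> c <= m x.
  move=> le_c; apply: lb_le_inf; last by move=> _ [p /le_c ? <-].
  by exists (p0 x), p0.
exists m; split=> //.
  split=> [x y|a x a0].
    rewrite -lerBlDr; apply: (m_ge) => p Ap.
    rewrite lerBlDl -lerBlDr; apply: (m_ge) => p' Ap'; rewrite lerBlDr.
    have [le_pp'|le_p'p] := Achain _ _ Ap Ap'.
      apply: le_trans (m_le p _ Ap) _; have := (Asub _ Ap).1.1 x y.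
      by have := le_pp' y; lra.
    apply: le_trans (m_le p' _ Ap') _; have := (Asub _ Ap').1.1 x y.
    by have := le_p'p x; lra.
  rewrite -ler_pdivrMl//; apply: (m_ge) => p Ap; rewrite ler_pdivrMl//.
  by apply: le_trans (m_le p _ Ap) _; exact: (Asub _ Ap).1.2.
by move=> x; apply: le_trans (m_le p0 _ Ap0) _; exact: (Asub _ Ap0).2.
Qed.

(** A minimal functional cannot be lowered by [slide], so it is already odd in
    every direction. *)
Lemma minimal_sublinear_odd m : sublinear m ->
  (forall p, sublinear p -> (forall x, p x <= m x) -> p = m) ->
  forall x, m (- x) = - m x.
Proof.
move=> sm m_min x; apply/eqP; rewrite eq_le; apply/andP; split.
  rewrite -{1}(m_min (slide m x)) ?slideN//; first exact: slide_sublinear.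
  by move=> y; exact: slide_ler.
by rewrite lerNl sublinear_geN.
Qed.

Lemma odd_sublinear_linear m : sublinear m -> (forall x, m (- x) = - m x) ->
  linear (m : X -> R^o).
Proof.
move=> sm m_odd.
have mD x y : m (x + y) = m x + m y.
  apply/eqP; rewrite eq_le sm.1/= -lerN2 -m_odd !opprD -!m_odd; exact: sm.1.
move=> a x y; rewrite mD; congr (_ + _).
rewrite -[RHS]/(a * m x).
have [a0|a0|->] := ltgtP a 0.
- by rewrite -[a]opprK scaleNr m_odd (sublinearZ _ sm) ?oppr_gt0// !mulNr.
- exact: sublinearZ.
- by rewrite scale0r mul0r sublinear0.
Qed.

(** Linear functionals are the minimal sublinear ones, so Zorn's lemma on
    sublinear functionals below [q] produces one without extending partially
    defined functionals. Starting from [slide q y] rather than from [q] bounds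
    the functional at [- y] and so forces the value [q y] at [y]. *)
Theorem hahn_banach q y : sublinear q ->
  exists phi : {linear X -> R^o}, (forall x, phi x <= q x) /\ phi y = q y.
Proof.
move=> sq; pose q' := slide q y; have sq' : sublinear q' := slide_sublinear y sq.
pose T := {p : X -> R | sublinear p /\ forall x, p x <= q' x}.
(* The order is reversed, for Zorn's lemma yields maximal elements. *)
pose ge (p p' : T) := `[< forall x, sval p' x <= sval p x >].
have [|||A Achain|m m_min] := @Zorn T ge.
- by move=> p; apply/asboolP => x.
- move=> p1 p2 p3 /asboolP le21 /asboolP le32; apply/asboolP => x.
  exact: le_trans (le21 x).
- move=> [p1 h1] [p2 h2] /asboolP /= le21 /asboolP /= le12.
  by apply: eq_exist; apply/funext => x; apply/eqP; rewrite eq_le le12 le21.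
- have [[p0 Ap0]|A0] := pselect (A !=set0); last first.
    by exists (exist _ q' (conj sq' (fun=> lexx _))) => s As; case: A0; exists s.
  have [||p p' [s As <-] [s' As' <-]|m [sm le_mq' le_m]] :=
      @chain_inf_sublinear q' [set sval p | p in A].
  + by exists (sval p0), p0.
  + by move=> _ [p _ <-]; exact: svalP p.
  + by have [/asboolP|/asboolP] := Achain _ _ As As'; [right|left].
  + exists (exist _ m (conj sm le_mq')) => s As; apply/asboolP => x /=.
    by apply: le_m; exists s.
case: m m_min => m [sm le_mq'] m_min.
have m_odd : forall x, m (- x) = - m x.
  apply: minimal_sublinear_odd => // p sp le_pm.
  have hp : sublinear p /\ forall x, p x <= q' x.
    by split=> // x; apply: le_trans (le_pm x) (le_mq' x).
  by have /(congr1 sval) := m_min (exist _ p hp) ltac:(exact/asboolP).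
pose L := GRing.isLinear.Build _ _ _ _ (m : X -> R^o) (odd_sublinear_linear sm m_odd).
pose phi : {linear X -> R^o} := HB.pack (m : X -> R^o) L.
exists phi; have le_mq x : m x <= q x := le_trans (le_mq' x) (slide_ler x y sq).
split=> //; apply/eqP; rewrite eq_le le_mq/=.
by rewrite -lerN2 -m_odd; apply: le_trans (slideN y sq); exact: le_mq'.
Qed.

End Sublinear.

(** * Uniform boundedness by a gliding hump *)
Section GlidingHump.
Context {R : realType} {X : lmodType R}.

Lemma natr_le_exp3 n : n%:R <= 3 ^+ n :> R.
Proof. by rewrite -natrX ler_nat ltnW// ltn_expl. Qed.

Lemma eq0_of_geometric_bound (c K : R) : (forall n, `|c| * 3 ^+ n <= K) -> c = 0.
Proof.
move=> cK; apply/eqP; rewrite -normr_eq0; apply/negPn/negP => c0.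
have c_gt0 : 0 < `|c| by rewrite lt_neqAle eq_sym c0 normr_ge0.
have K0 : 0 <= K by apply: le_trans (cK 0%N); rewrite expr0 mulr1.
have := archi_boundP (divr_ge0 K0 (ltW c_gt0)).
set n := Num.bound _; rewrite ltr_pdivrMr// mulrC ltNge => /negP; apply.
apply: le_trans (cK n); rewrite ler_pM2l//; exact: natr_le_exp3.
Qed.

(** If [q (x n) > n * 3 ^ n] for points [x n] of [B], let [phi n] be a functional
    below [q] that attains it at [x n], and sum the [phi n] with weights [3^-n]
    and signs chosen in turn so that the partial sum is at least
    [3^-n * q (x n)] at [x n]. The remaining terms can cancel at most half of
    this, so the sum is larger than [n / 2] at [x n] and is not bounded on [B].
    This sign argument is due to Sokal and avoids the Baire category theorem. *)
Lemma uniform_boundedness (q : X -> R) (B : set X) : seminorm q ->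
  (forall phi : {linear X -> R^o}, (forall x, `|phi x| <= 2 * q x) ->
     exists M, forall x, B x -> `|phi x| <= M) ->
  exists M, forall x, B x -> q x <= M.
Proof.
move=> sq Bbdd; apply: contrapT => q_unbdd.
have q0 x : 0 <= q x := seminorm_ge0 x sq.
have /choice[x xP] : forall n, exists x, B x /\ n%:R * 3 ^+ n < q x.
  move=> n; apply: contrapT => nx; apply: q_unbdd; exists (n%:R * 3 ^+ n) => y By.
  by rewrite leNgt; apply/negP => lt_y; apply: nx; exists y.
have /choice[phi phiP] :
    forall n, exists phi : {linear X -> R^o},
      (forall y, `|phi y| <= q y) /\ phi (x n) = q (x n).
  move=> n; have [phi [le_phi phix]] :=
    hahn_banach (x n) (seminorm_sublinear sq).
  by exists phi; split=> // y; exact: seminorm_ler_norm.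
pose w n : R := (3 ^+ n)^-1.
have w_gt0 n : 0 < w n by rewrite invr_gt0 exprn_gt0.
have wS n : w n = 3 * w n.+1.
  by rewrite /w exprS invfM mulrA divff ?mul1r// ?pnatr_eq0.
(* One of [a + b] and [a - b] is at least [b] in absolute value. *)
pose sg (a b : R) : R := if `|a - b| <= `|a + b| then 1 else -1.
have sg_norm a b : `|sg a b| = 1.
  by rewrite /sg; case: ifP => _; rewrite ?normrN normr1.
have sg_ge a b : 0 <= b -> b <= `|a + sg a b * b|.
  move=> b0; have := ler_normB (a + b) (a - b).
  rewrite (_ : a + b - (a - b) = 2 * b); last by ring.
  rewrite normrM (@ger0_norm _ 2)// (ger0_norm b0) /sg.
  by case: (lerP `|a - b| `|a + b|) => ? ?; rewrite ?mul1r ?mulN1r; lra.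
pose P := fix P n : X -> R := if n is k.+1 then
  fun z => P k z + sg (P k (x k)) (w k * q (x k)) * (w k * phi k z) else fun=> 0.
have PD n y z : P n (y + z) = P n y + P n z.
  elim: n => [|n IH] /=; first by rewrite addr0.
  by rewrite IH linearD; ring.
have PZ n a z : P n (a *: z) = a * P n z.
  elim: n => [|n IH] /=; first by rewrite mulr0.
  by rewrite IH linearZ/= -[_ *: phi n z]/(a * phi n z); ring.
have Pstep n z : `|P n.+1 z - P n z| <= w n * q z.
  rewrite /= addrC addKr normrM sg_norm mul1r normrM gtr0_norm//.
  by rewrite ler_pM2l// (phiP n).1.
have Pcauchy n k z : `|P (n + k)%N z - P n z| <= 3 / 2 * (w n - w (n + k)%N) * q z.
  elim: k => [|k IH]; first by rewrite addn0 !subrr normr0 mulr0 mul0r.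
  have := Pstep (n + k)%N z; rewrite addnS => le_step.
  have := ler_normD (P (n + k).+1 z - P (n + k)%N z) (P (n + k)%N z - P n z).
  rewrite addrA subrK => /le_trans; apply.
  apply: le_trans (lerD le_step IH) _; rewrite (wS (n + k)%N); lra.
have Ple n m z : P m z - 3 / 2 * w m * q z <= P n z + 3 / 2 * w n * q z.
  have [le_nm|/ltnW le_mn] := leqP n m.
    have := Pcauchy n (m - n)%N z; rewrite subnKC// ler_norml => /andP[_].
    have := mulr_ge0 (ltW (w_gt0 m)) (q0 z).
    by lra.
  have := Pcauchy m (n - m)%N z; rewrite subnKC// ler_norml => /andP[+ _].
  have := mulr_ge0 (ltW (w_gt0 n)) (q0 z).
  by lra.
(* The supremum of these lower bounds is the limit of [P n z]; it lies within
   [3 / 2 * w n * q z], the sum of the geometric tail, of each [P n z]. *)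
pose Phi z := sup [set P n z - 3 / 2 * w n * q z | n in [set: nat]].
have PhiP n z : `|Phi z - P n z| <= 3 / 2 * w n * q z.
  rewrite ler_distl; apply/andP; split.
    apply: ub_le_sup; last by exists n.
    by exists (P n z + 3 / 2 * w n * q z) => _ [m _ <-].
  apply: ge_sup; last by move=> _ [m _ <-].
  by exists (P n z - 3 / 2 * w n * q z), n.
have wV n : w n * 3 ^+ n = 1 by rewrite mulVf// expf_eq0 pnatr_eq0 andbF.
have scale_bound n c : 3 / 2 * w n * c * 3 ^+ n = 3 / 2 * c.
  by rewrite -mulrA [c * _]mulrC mulrA -[3 / 2 * _ * _]mulrA wV mulr1.
have PhiZ a z : Phi (a *: z) = a * Phi z.
  apply/eqP; rewrite -subr_eq0; apply/eqP.
  apply: (@eq0_of_geometric_bound _ (3 / 2 * (2 * `|a| * q z))) => n.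
  rewrite -(scale_bound n) ler_pM2r ?exprn_gt0//.
  have := PhiP n (a *: z); rewrite PZ sq.2 => h1.
  have h2 : `|a * P n z - a * Phi z| <= `|a| * (3 / 2 * w n * q z).
    by rewrite -mulrBr normrM distrC ler_wpM2l.
  have := ler_normD (Phi (a *: z) - a * P n z) (a * P n z - a * Phi z).
  by rewrite addrA subrK; lra.
have PhiD y z : Phi (y + z) = Phi y + Phi z.
  apply/eqP; rewrite -subr_eq0; apply/eqP.
  apply: (@eq0_of_geometric_bound _ (3 / 2 * (2 * (q y + q z)))) => n.
  rewrite -(scale_bound n) ler_pM2r ?exprn_gt0//.
  have h1 := PhiP n (y + z); have h2 := PhiP n y; have h3 := PhiP n z.
  have h4 : 3 / 2 * w n * q (y + z) <= 3 / 2 * w n * (q y + q z).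
    by rewrite ler_wpM2l ?sq.1// mulr_ge0// ?ltW//; lra.
  move: h1 h2 h3; rewrite !ler_norml PD => /andP[? ?] /andP[? ?] /andP[? ?].
  by apply/andP; split; lra.
have Phi_lin : linear (Phi : X -> R^o).
  by move=> a y z; rewrite PhiD PhiZ.
pose L := GRing.isLinear.Build _ _ _ _ (Phi : X -> R^o) Phi_lin.
pose PhiL : {linear X -> R^o} := HB.pack (Phi : X -> R^o) L.
have [|M BM] := Bbdd PhiL.
  move=> z; have := PhiP 0%N z; rewrite /= subr0 /w expr0 invr1 => /le_trans; apply.
  by have := q0 z; lra.
have M0 : 0 <= M by apply: le_trans (BM _ (xP 0%N).1); exact: normr_ge0.
pose n := Num.bound (2 * M).
have lt_n : 2 * M < n%:R by apply: archi_boundP; lra.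
have := BM _ (xP n).1; rewrite leNgt => /negP; apply => /=.
have n_lt : n%:R < w n * q (x n).
  by rewrite mulrC ltr_pdivlMr ?exprn_gt0// (xP n).2.
have := PhiP n.+1 (x n); have := sg_ge (P n (x n)) (w n * q (x n)).
move=> /(_ (mulr_ge0 (ltW (w_gt0 n)) (q0 _))).
rewrite /= (phiP n).2; set a := P n _ + _ => le_a.
have -> : 3 / 2 * w n.+1 * q (x n) = w n * q (x n) / 2 by rewrite (wS n); lra.
have := ler_normD (a - Phi (x n)) (Phi (x n)); rewrite subrK distrC.
by lra.
Qed.

End GlidingHump.

(** * Completely metrizable spaces and the Baire property *)
Section CompletelyMetrizable.
Context {R : realType}.

(** The consequence of a complete metric behind both category arguments below,
    with [W n x] the ball of radius [1 / (n + 1)]: it is phrased with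
    neighbourhoods only, so it applies to the topology of [E]. *)
Lemma shrinking_nbhs (T : topologicalType) : completely_metrizable R T ->
  exists W : nat -> T -> set T, (forall n (x : T), nbhs x (W n x)) /\
    forall u : nat -> T, (forall n m, (n <= m)%N -> W n (u n) (u m)) ->
      exists x : T, u @ \oo --> x.
Proof.
move=> [m [/= nbhsE complete]]; pose M : metricType R := Metric.Pack m.
pose W n (x : M) : set M := ball x (n.+1%:R^-1 : R).
exists W; split=> [n x|u uW].
  by rewrite nbhsE; apply: (@nbhsx_ballx _ M); rewrite invr_gt0 ltr0n.
have [|x ux] := complete ((u : nat -> M) @ \oo) _.
  apply: (@cauchy_exP _ M) => e e0.
  have [N _ Ne] := near_infty_natSinv_lt (PosNum e0).
  exists (u N); exists N => // k /= leNk.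
  apply: (@le_ball _ M _ (N.+1%:R^-1)); first exact/ltW/(Ne N)/leqnn.
  exact: uW.
by exists x => A; rewrite nbhsE => /ux.
Qed.

Lemma baire (T : uniformType) (C : nat -> set T) :
  completely_metrizable R T -> [set: T] !=set0 ->
  (forall n, closed (C n)) -> \bigcup_n C n = setT ->
  exists n (x : T), nbhs x (C n).
Proof.
move=> /shrinking_nbhs[W [Wnbhs Wcvg]] [x0 _] Cclosed Ccover.
apply: contrapT => Cint.
pose state := {s : nat * T * set T | nbhs s.1.2 s.2}.
pose step (s s' : state) := (sval s').1.1 = (sval s).1.1.+1 /\
  closure (sval s').2 `<=`
    (sval s).2 `&` ~` C (sval s).1.1 `&` W (sval s).1.1 (sval s').1.2.
have stepP s : {s' | step s s'}.
  apply: cid; case: s => [[[k x] V] /= Vx].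
  have [x' [Vx' nCx']] : exists x', V^° x' /\ ~ C k x'.
    apply: contrapT => VC; apply: Cint; exists k, x.
    apply: filterS (nbhs_interior Vx) => y Vy.
    by apply: contrapT => nCy; apply: VC; exists y.
  have : nbhs x' (V `&` ~` C k `&` W k x').
    apply: filterI (Wnbhs k x'); apply: filterI => //.
    by apply: open_nbhs_nbhs; split=> //; exact/closed_openC.
  move=> /(@uniform_regular T x')[V' V'x' clV'].
  by exists (exist _ (k.+1, x', V') V'x').
have [s0 s0k] : exists s : state, (sval s).1.1 = 0%N.
  by unshelve eexists (exist _ (0%N, x0, setT) _) => //=; exact: filterT.
have [f [f0 fS]] := dependent_choice stepP s0.
have fk n : (sval (f n)).1.1 = n by elim: n => [|n IH]; rewrite ?f0// (fS n).1 IH.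
pose V n := (sval (f n)).2; pose u n := (sval (f n.+1)).1.2.
have clV n : closure (V n.+1) `<=` V n `&` ~` C n `&` W n (u n).
  by have := (fS n).2; rewrite fk.
have V_decr n m : (n <= m)%N -> V m `<=` V n.
  move=> /subnKC <-; elim: (m - n)%N => [|k IH]; first by rewrite addn0.
  by rewrite addnS => y /subset_closure/clV[[/IH]].
have uV n : V n.+1 (u n) by exact: nbhs_singleton (svalP (f n.+1)).
have uV_late n m : (n <= m)%N -> V n.+1 (u m).
  by move=> le_nm; apply: (V_decr n.+1 m.+1).
have [|l ul] := Wcvg u.
  by move=> n m /uV_late /subset_closure /clV[].
have [n _ Cnl] : (\bigcup_n C n) l by rewrite Ccover.
suff /clV[[_]] : closure (V n.+1) l by [].
apply: (closed_cvg _ _ _ _ ul); first exact: closed_closure.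
by exists n => // m /= /uV_late; exact: subset_closure.
Qed.

End CompletelyMetrizable.

(** * Lower semicontinuous seminorms on a Frechet space *)
Section BarrelledNorm.
Context {R : realType} {E : tvsType R}.
Implicit Types (p : E -> R).

Lemma translation_continuous (x : E) : continuous (fun y => x + y).
Proof.
by move=> y; apply: (cvg_comp2 (cvg_cst _) cvg_id (add_continuous (_, _))).
Qed.

Lemma dilation_continuous (a : R) : continuous (fun y : E => a *: y).
Proof.
move=> y; exact: (@cvg_comp _ _ _ (fun y => (a : R^o, y)) (fun z => z.1 *: z.2) _ _ _
  (cvg_pair (cvg_cst _) cvg_id) (@scale_continuous R E (a, y))).
Qed.

Lemma nbhs0_scaled (a : R) (A : set E) : nbhs 0 A -> nbhs 0 [set x | A (a *: x)].
Proof.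
by move=> A0; apply: (@dilation_continuous a 0 A); rewrite scaler0.
Qed.

Lemma nbhs_translated (x : E) (A : set E) :
  nbhs x A <-> nbhs 0 [set y | A (x + y)].
Proof.
split=> [Ax|A0].
  by apply: (@translation_continuous x 0 A); rewrite addr0.
have : nbhs x [set y | A (x + (- x + y))].
  by apply: (@translation_continuous (- x) x [set y | A (x + y)]); rewrite addNr.
by apply: filterS => y /=; rewrite addrA subrr add0r.
Qed.

(** The multiples of the closed unit ball cover [E], so one of them has an
    interior point [x]; subtracting [x] gives a ball around [0]. *)
Lemma closed_seminorm_continuous p : frechet_space E -> seminorm p ->
  closed [set x | p x <= 1] -> forall e, 0 < e -> nbhs 0 [set x | p x < e].
Proof.
move=> hE sp clp e e0.
have [|||n [x px]] := @baire R E (fun n => [set x | p x <= n.+1%:R]) hE.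
- by exists 0.
- move=> n; have -> : [set x | p x <= n.+1%:R] =
      (fun x : E => n.+1%:R^-1 *: x) @^-1` [set x | p x <= 1].
    apply/seteqP; split=> x /=; rewrite sp.2 ger0_norm ?invr_ge0//;
      by rewrite ler_pdivrMl ?mulr1 ?ltr0n.
  apply: closed_comp => // x _; exact: dilation_continuous.
- apply/seteqP; split=> // x _; exists (Num.bound (p x)) => //=.
  apply/ltW/(lt_le_trans (archi_boundP (seminorm_ge0 x sp))).
  by rewrite ler_nat.
have le_x : p x <= n.+1%:R := nbhs_singleton px.
move/nbhs_translated: px => /(nbhs0_scaled (4 * n.+1%:R / e)).
apply: filterS => y /= le_xy.
have n0 : 0 < n.+1%:R :> R by rewrite ltr0n.
have c0 : 0 < 4 * n.+1%:R / e by rewrite divr_gt0// mulr_gt0.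
have := sp.1 (x + (4 * n.+1%:R / e) *: y) (- x).
rewrite addrC addKr seminormN// sp.2 gtr0_norm// => le_y.
have : 4 * n.+1%:R / e * p y <= 2 * n.+1%:R by lra.
rewrite mulrAC ler_pdivrMr// -mulrA -subr_ge0 => le_y'.
have : 0 <= n.+1%:R * (e - 2 * p y) by lra.
by rewrite pmulr_rge0//; lra.
Qed.

End BarrelledNorm.

(** * Completeness of a norm on a completely metrizable space *)
Section Klee.
Context {R : realType} {E : preTopologicalLmodType R}.

(** Klee's theorem. With [xi] the limit of [F] in the completion, both [E] and
    [xi - E] are dense G-delta sets there, so they meet: [xi = y + z] with [y]
    and [z] in [E]. The completion is avoided by a direct construction, in which
    [F (norm_ball p x r)] stands for [p (xi - x) < r]: points [a n] with
    [a n + a n.+1] ever closer to [xi], where [a n.+2] corrects [a n] and lies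
    in a neighbourhood of it chosen small for the complete metric. Then the
    points of even index converge to some [y], those of odd index to some [z],
    and [F] converges to [y + z]. *)
Lemma completely_metrizable_norm_complete (p : E -> R) :
  completely_metrizable R E -> seminorm p ->
  (forall x : E, nbhs x = nbhs_ball_ (norm_ball p) x) ->
  forall F : set_system E, ProperFilter F ->
    (forall e, 0 < e -> exists x, F (norm_ball p x e)) ->
    exists x : E, F --> x.
Proof.
move=> /shrinking_nbhs[W [Wnbhs Wcvg]] sp nbhsE F FF Fcauchy.
have tri x y z : p (x - z) <= p (x - y) + p (y - z).
  by rewrite -[x - z](subrKA y) sp.1.
have ballxx x r : 0 < r -> norm_ball p x r x.
  by rewrite /norm_ball /= subrr (sublinear0 (seminorm_sublinear sp)).
(* [a'] replaces [a] so that [a' + b] is within [s] of the virtual limit, where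
   [s] is the radius attached to [b]: this is what later allows [b] to be
   replaced without leaving its ball. The index [k./2] makes the even and the
   odd points each meet [W 0], [W 1], [W 2] and so on. *)
have refine k a r b s : 0 < r -> 0 < s -> F (norm_ball p (a + b) r) ->
    exists a' r', [/\ 0 < r', r' <= k.+1%:R^-1,
      norm_ball p a' r' `<=` norm_ball p a r `&` W k./2 a' &
      F (norm_ball p (b + a') s)].
  move=> r0 s0 Fab.
  have [x Fx] := Fcauchy (s / 2) (divr_gt0 s0 (ltr0Sn R 1)).
  have [t [/= abt xt]] := filter_ex (filterI Fab Fx).
  pose a' := t - b.
  have lt_aa' : p (a - a') < r by rewrite opprB addrA.
  have : nbhs a' (norm_ball p a r `&` W k./2 a').
    apply: filterI (Wnbhs _ _); rewrite nbhsE.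
    exists (r - p (a - a')) => [|z] /=; first by rewrite subr_gt0.
    by rewrite /norm_ball /= => a'z; have := tri a a' z; lra.
  rewrite nbhsE => -[e /= e0 ball_e].
  exists a', (Num.min e k.+1%:R^-1); split.
  - by rewrite lt_min e0 invr_gt0 ltr0n.
  - by rewrite ge_min lexx orbT.
  - by move=> z; rewrite /norm_ball /= lt_min => /andP[? _]; exact: ball_e.
  - apply: filterS Fx => z; rewrite /norm_ball /= /a' [b + _]addrC subrK => xz.
    by have := tri t x z; rewrite (seminormB t x sp); move: xt; rewrite /norm_ball/=; lra.
(* A state [(k, (a, r), (b, s))] holds the step number, the point to be replaced
   next and the point replaced last, each with its radius. *)
pose state := {s : nat * (E * R) * (E * R) | [/\ 0 < s.1.2.2, 0 < s.2.2 &
  F (norm_ball p (s.1.2.1 + s.2.1) s.1.2.2)]}.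
pose step (s s' : state) := [/\ (sval s').1.1 = (sval s).1.1.+1,
  (sval s').1.2 = (sval s).2, (sval s').2.2 <= (sval s).1.1.+1%:R^-1 &
  norm_ball p (sval s').2.1 (sval s').2.2 `<=`
    norm_ball p (sval s).1.2.1 (sval s).1.2.2 `&`
    W (sval s).1.1./2 (sval s').2.1].
have stepP s : {s' | step s s'}.
  apply: cid; case: s => [[[k [a r]] [b s]] /= [r0 s0 Fab]].
  have [a' [r' [r'0 r'k ball_r' Fba']]] := refine k a r b s r0 s0 Fab.
  have s'P : [/\ 0 < s, 0 < r' & F (norm_ball p (b + a') s)] by [].
  by exists (exist _ (k.+1, (b, s), (a', r')) s'P).
have [s0 s0k] : exists s : state, (sval s).1.1 = 0%N.
  have [x Fx] := Fcauchy 1 ltr01.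
  unshelve eexists (exist _ (0%N, (x, 1), (0, 1)) _) => //=.
  by split=> //; rewrite addr0.
have [f [f0 fS]] := dependent_choice stepP s0.
have fk n : (sval (f n)).1.1 = n.
  by elim: n => [|n IH]; rewrite ?f0//; have [-> _ _ _] := fS n; rewrite IH.
pose a n := (sval (f n)).1.2.1; pose r n := (sval (f n)).1.2.2.
have newer n : (sval (f n)).2 = (a n.+1, r n.+1).
  by rewrite /a /r; have [_ -> _ _] := fS n; case: (sval (f n)).2.
have r_gt0 n : 0 < r n by have [] := svalP (f n).
have Fa n : F (norm_ball p (a n + a n.+1) (r n)).
  by have [_ _] := svalP (f n); rewrite newer.
have r_le n : r n.+2 <= n.+1%:R^-1.
  by have [_ _] := fS n; rewrite newer fk.
have ball_a n : norm_ball p (a n.+2) (r n.+2) `<=`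
    norm_ball p (a n) (r n) `&` W n./2 (a n.+2).
  by have [_ _ _] := fS n; rewrite newer fk.
have ball_nested n j : norm_ball p (a (n + j.*2)%N) (r (n + j.*2)%N) `<=`
    norm_ball p (a n) (r n).
  elim: j => [|j IH]; first by rewrite addn0.
  by rewrite doubleS !addnS => z /ball_a[/IH].
have half_cvg i : (i <= 1)%N ->
    exists l : E, (fun j => a (i + j.*2).+2) @ \oo --> l.
  move=> i1; apply: Wcvg => j m /subnKC <-.
  have [_] : (norm_ball p (a (i + j.*2)) (r (i + j.*2)) `&`
      W (i + j.*2)./2 (a (i + j.*2).+2)) (a (i + (j + (m - j)).*2).+2).
    apply: ball_a; rewrite doubleD addnA -!addSn.
    by apply: ball_nested; exact: ballxx.
  by rewrite halfD doubleK odd_double andbF; case: i i1 => [|[|]].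
have [y ay] := half_cvg 0%N isT; have [z az] := half_cvg 1%N isT.
exists (y + z) => A; rewrite nbhsE => -[e /= e0 ball_eA].
have e4 : 0 < e / 4 by rewrite divr_gt0.
have ball_nbhs x : nbhs x (norm_ball p x (e / 4)).
  by rewrite nbhsE; exists (e / 4).
have [N1 _ yN1] := ay _ (ball_nbhs y).
have [N2 _ zN2] := az _ (ball_nbhs z).
have [N3 _ eN3] := near_infty_natSinv_lt (PosNum e4).
pose N := maxn N1 (maxn N2 N3).
have := yN1 N (leq_maxl _ _); rewrite /norm_ball /= add0n => lt_y.
have := zN2 N; rewrite /norm_ball /= leq_max leq_maxl orbT => /(_ isT) lt_z.
have := eN3 N.*2; rewrite /= => lt_N.
have {lt_N} lt_r : r N.*2.+2 < e / 4.
  apply: le_lt_trans (r_le _) (lt_N _).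
  by rewrite -addnn (leq_trans _ (leq_addr _ _))// !leq_max leqnn !orbT.
apply: filterS (Fa N.*2.+2) => t; rewrite /norm_ball /= => lt_t.
apply: ball_eA; rewrite /norm_ball /=.
have := tri (y + z) (a N.*2.+2 + a N.*2.+3) t.
have := sp.1 (y - a N.*2.+2) (z - a N.*2.+3).
by rewrite addrACA -opprD; move: lt_z; rewrite add1n; lra.
Qed.

End Klee.

(** * Gauges and locally convex neighbourhoods *)
Section Gauge.
Context {R : realType} {X : lmodType R}.

Lemma even_sublinear_seminorm (q : X -> R) : sublinear q ->
  (forall x, q (- x) = q x) -> seminorm q.
Proof.
move=> sq q_even; split=> [|a x]; first exact: sq.1.
have [a0|a0|->] := ltgtP a 0.
- by rewrite -q_even -scaleNr (sublinearZ _ sq) ?oppr_gt0// ltr0_norm.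
- by rewrite (sublinearZ _ sq)// gtr0_norm.
- by rewrite scale0r (sublinear0 sq) normr0 mul0r.
Qed.

Definition gauge (U : set X) (x : X) : R := inf [set t | 0 < t /\ U (t^-1 *: x)].

Context (U : set X).
Context (Uconvex : forall x y (a b : R), U x -> U y -> 0 <= a -> 0 <= b ->
  a + b = 1 -> U (a *: x + b *: y)).
Context (Usym : forall x, U x -> U (- x)).
Context (Uabsorbing : forall x, exists2 t : R, 0 < t & U (t^-1 *: x)).

Lemma gauge_le x t : 0 < t -> U (t^-1 *: x) -> gauge U x <= t.
Proof. by move=> t0 Ux; apply: ge_inf; [exists 0 => s [/ltW]|split]. Qed.

Lemma gauge_ge x c : (forall t, 0 < t -> U (t^-1 *: x) -> c <= t) -> c <= gauge U x.
Proof.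
move=> le_c; apply: lb_le_inf; last by move=> t [t0 /(le_c _ t0)].
by have [t t0 Ux] := Uabsorbing x; exists t.
Qed.

Lemma gauge_sublinear : sublinear (gauge U).
Proof.
split=> [x y|a x a0].
  rewrite -lerBlDr; apply: gauge_ge => t t0 Ux.
  rewrite lerBlDl -lerBlDr; apply: gauge_ge => s s0 Uy; rewrite lerBlDr.
  have st0 : 0 < s + t by exact: addr_gt0.
  apply: gauge_le => //.
  have -> : (s + t)^-1 *: (x + y) =
      (t / (s + t)) *: (t^-1 *: x) + (s / (s + t)) *: (s^-1 *: y).
    by rewrite !scalerA scalerDr; congr (_ *: _ + _ *: _); field; lra.
  by apply: Uconvex => //; rewrite ?divr_ge0 ?ltW//; field; lra.
rewrite -ler_pdivrMl//; apply: gauge_ge => t t0 Ux; rewrite ler_pdivrMl//.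
apply: gauge_le; first exact: mulr_gt0.
by rewrite scalerA (_ : (a * t)^-1 * a = t^-1)//; field; lra.
Qed.

Lemma gauge_seminorm : seminorm (gauge U).
Proof.
apply: even_sublinear_seminorm gauge_sublinear _ => x.
congr (inf _); apply/seteqP; split=> t [t0 /Usym] /=;
  by rewrite scalerN ?opprK.
Qed.

Lemma gauge_lt1 x : gauge U x < 1 -> U x.
Proof.
have [t0 t0_gt0 Ut0] := Uabsorbing x.
move=> /inf_lt[|t [t_gt0 Ux] t1]; first by exists t0.
have U0 : U 0.
  have := @Uconvex _ _ 2^-1 2^-1 Ut0 (Usym Ut0).
  by rewrite scalerN subrr; apply; rewrite ?invr_ge0//; lra.
have := @Uconvex _ _ t (1 - t) Ux U0 (ltW t_gt0).
rewrite scalerA divff ?gt_eqF// scale1r scaler0 addr0.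
by apply; lra.
Qed.

End Gauge.

Section LocallyConvex.
Context {R : realType} {E : tvsType R}.

Lemma tvs_absorbing (U : set E) x : nbhs 0 U -> exists2 t : R, 0 < t & U (t^-1 *: x).
Proof.
move=> U0; have : nbhs (0 : R^o) [set a : R^o | U (a *: x)].
  apply: (@cvg_comp _ _ _ (fun a : R^o => (a, x)) (fun z => z.1 *: z.2) _ _ _
    (cvg_pair cvg_id (cvg_cst _)) (@scale_continuous R E (0, x))).
  by rewrite /= scale0r.
move=> /nbhs_ballP[e /= e0 eU]; exists (2 / e); first by rewrite divr_gt0.
apply: eU; rewrite /ball /= sub0r normrN gtr0_norm ?invr_gt0 ?divr_gt0//.
by rewrite invf_div; lra.
Qed.

(** The gauge of a convex neighbourhood made symmetric. *)
Lemma seminorm_basis (A : set E) : nbhs 0 A ->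
  exists q : E -> R, [/\ seminorm q, nbhs 0 [set x | q x <= 1] &
    forall x, q x < 1 -> A x].
Proof.
move=> A0; have [B Bconvex [Bopen Bbasis]] := @locally_convex R E.
have [V [BV V0] VA] := Bbasis 0 A A0.
pose U := V `&` [set x | V (- x)].
have V0nbhs : nbhs 0 V by apply: open_nbhs_nbhs; split=> //; exact: Bopen.
have U0 : nbhs 0 U.
  apply: filterI => //; have := nbhs0_scaled (-1) V0nbhs.
  by apply: filterS => x /=; rewrite scaleN1r.
have Vconvex x y (a b : R) : V x -> V y -> 0 <= a -> 0 <= b -> a + b = 1 ->
    V (a *: x + b *: y).
  move=> Vx Vy a0 b0 ab1.
  have a1 : a <= 1 by lra.
  have /set_mem := Bconvex V (mem_set BV) x y (Itv01 a0 a1) (mem_set Vx) (mem_set Vy).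
  by rewrite /conv /= /unstable.onem (_ : 1 - a = b)//; lra.
have Uconvex x y (a b : R) : U x -> U y -> 0 <= a -> 0 <= b -> a + b = 1 ->
    U (a *: x + b *: y).
  move=> [Vx VNx] [Vy VNy] a0 b0 ab1; split; first exact: Vconvex.
  by rewrite /= opprD -!scalerN; exact: Vconvex.
have Usym x : U x -> U (- x) by move=> [? ?]; split; rewrite /= ?opprK.
have Uabs x := tvs_absorbing x U0.
exists (gauge U); split; first exact: gauge_seminorm.
  by apply: filterS U0 => x Ux; apply: gauge_le; rewrite ?invr1 ?scale1r.
by move=> x /(gauge_lt1 Uconvex Usym Uabs)[/VA].
Qed.

Lemma nbhs0_bounded_linear_continuous (phi : {linear E -> R^o}) (V : set E) (M : R) :
  nbhs 0 V -> (forall x, V x -> `|phi x| <= M) -> continuous phi.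
Proof.
move=> V0 phiM x; apply/cvgrPdist_lt => /= e e0; apply/nbhs_translated.
have M0 : 0 <= M := le_trans (normr_ge0 _) (phiM _ (nbhs_singleton V0)).
apply: filterS (nbhs0_scaled ((M + 1) / e) V0) => y /phiM /=.
have Me : 0 < (M + 1) / e by rewrite divr_gt0//; lra.
rewrite linearZ linearD opprD addrA subrr sub0r normrN.
rewrite normrM gtr0_norm// mulrAC ler_pdivrMr// => le_phi.
rewrite -subr_gt0 -(@pmulr_rgt0 _ (M + 1)); lra.
Qed.

End LocallyConvex.

(** * Convergence in the weak topology and in [C_p(K)] *)
Lemma cvg_initial (S : choiceType) (T : topologicalType) (f : S -> T)
    (F : set_system S) (x : S) : Filter F ->
  F --> (x : initial_topology f) <-> f @ F --> f x.
Proof.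
move=> FF; split=> [Fx A /initial_continuous /Fx //|fFx].
move=> A [_ [[B oB <-] Bfx] BA]; apply: filterS BA _.
by apply: fFx; exact: open_nbhs_nbhs.
Qed.

Lemma cvg_weak (R : realType) (E : tvsType R) (F : set_system E) (x : E) :
  Filter F ->
  F --> (x : weak E) <-> forall phi : dual E, sval phi @ F --> sval phi x.
Proof.
move=> FF; split=> [Fx phi|Fx].
  by apply/cvg_initial; exact: ((cvg_sup _ _ _).1 Fx phi).
by apply/cvg_sup => phi; apply/cvg_initial; exact: Fx.
Qed.

Lemma cvg_Cp (R : realType) (K : topologicalType) (F : set_system (Cp R K))
    (h : Cp R K) : Filter F ->
  F --> h <-> forall k, (fun g : Cp R K => (val g k : R^o)) @ F --> (val h k : R^o).
Proof.
move=> FF; split=> [/cvg_initial Fh k|Fh].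
  have : val @ F --> (val h : {ptws K -> R^o}) by [].
  by move=> /pointwise_cvgP/(_ k).
apply/cvg_initial; have : val @ F --> (val h : {ptws K -> R^o}) by apply/pointwise_cvgP.
by [].
Qed.

Section WeakTopology.
Context {R : realType} {E : tvsType R}.

Lemma dual_weak_continuous (phi : dual E) : continuous (sval phi : weak E -> R^o).
Proof.
move=> x.
by apply: ((@cvg_weak R E (nbhs (x : weak E)) x _).1 _ phi); exact: cvg_id.
Qed.

Lemma weak_continuous_continuous (T : topologicalType) (g : weak E -> T) :
  continuous g -> continuous (g : E -> T).
Proof.
move=> cg x; apply: cvg_trans (cg x); apply: cvg_app.
by apply/cvg_weak => phi; exact: svalP phi x.
Qed.

End WeakTopology.

(** * The norm given by an embedding in [C_p(K)] *)
Section UniformNorm.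
Context {R : realType} {K : topologicalType}.
Implicit Types (g h : Cp R K) (k : K).

Lemma Cp_addE g h k : val (g + h) k = val g k + val h k.
Proof. by []. Qed.

Lemma Cp_scaleE a g k : val (a *: g) k = a * val g k.
Proof. by []. Qed.

Lemma Cp_oppE g k : val (- g) k = - val g k.
Proof. by []. Qed.

Lemma Cp_continuous g : continuous (val g : K -> R^o).
Proof. by case: g => g /= gP; apply/asboolP. Qed.

(** The value [0] is added to the set so that it has a supremum, equal to [0],
    when [K] is empty. *)
Definition unorm g : R := sup [set t | t = 0 \/ exists k, t = `|val g k|].

Context (Kcompact : compact [set: K]).

Lemma unorm_has_ubound g : has_ubound [set t | t = 0 \/ exists k, t = `|val g k|].
Proof.
have : compact ((val g : K -> R^o) @` setT).
  apply: continuous_compact Kcompact; apply: continuous_subspaceT.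
  exact: Cp_continuous.
move=> /compact_bounded[M [_ Mbound]]; exists (`|M| + 1) => _ [->|[k ->]].
  by apply: addr_ge0.
apply: Mbound; last by exists k.
by have := ler_norm M; lra.
Qed.

Lemma unorm_ge g k : `|val g k| <= unorm g.
Proof. by apply: ub_le_sup (unorm_has_ubound g) _ _; right; exists k. Qed.

Lemma unorm_le g c : 0 <= c -> (forall k, `|val g k| <= c) -> unorm g <= c.
Proof.
move=> c0 le_c; apply: ge_sup => [|_ [->//|[k ->]]]; last exact: le_c.
by exists 0; left.
Qed.

Lemma unorm_ge0 g : 0 <= unorm g.
Proof. by apply: ub_le_sup (unorm_has_ubound g) _ _; left. Qed.

Lemma unorm_seminorm : seminorm unorm.
Proof.
apply: even_sublinear_seminorm; last first.
  move=> g; congr sup; apply/seteqP; split=> t [->|[k ->]]; try (by left);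
    by right; exists k; rewrite Cp_oppE normrN.
split=> [g h|a g a0].
  apply: unorm_le; first by rewrite addr_ge0// unorm_ge0.
  move=> k; rewrite Cp_addE (le_trans (ler_normD _ _))//.
  by rewrite lerD// unorm_ge.
apply: unorm_le; first by rewrite mulr_ge0 ?unorm_ge0// ltW.
by move=> k; rewrite Cp_scaleE normrM gtr0_norm// ler_pM2l// unorm_ge.
Qed.

(** Uniform convergence implies pointwise convergence. *)
Lemma Cp_nbhs0_unorm (V : set (Cp R K)) : nbhs 0 V ->
  exists2 d, 0 < d & forall g, unorm g <= d -> V g.
Proof.
pose F : set_system (Cp R K) :=
  filter_from [set d | 0 < d] (fun d => [set g | unorm g <= d]).
have FF : Filter F.
  apply: filter_from_filter; first by exists 1 => /=.
  move=> d d' d0 d'0; exists (Num.min d d').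
    by rewrite /= lt_min d0.
  by move=> g /=; rewrite le_min => /andP[].
suff F0 : F --> (0 : Cp R K) by move=> /F0[d d0 dV]; exists d.
apply/cvg_Cp => k; apply/cvgrPdist_le => e e0.
exists e => // g /= le_e; rewrite sub0r normrN.
exact: le_trans (unorm_ge g k) le_e.
Qed.

End UniformNorm.

Section EberleinGrothendieckNorm.
Context {R : realType} {E : tvsType R}.

(** Equality of the two topologies comes from [closed_seminorm_continuous] in one
    direction and, in the other, from the dual being bounded on the unit ball of
    [p]; Klee's theorem then gives completeness. *)
Lemma EG_norm : frechet_space E ->
  linearly_Eberlein_Grothendieck (weak E) -> generated_by_complete_norm E.
Proof.
move=> hE [K [Kcompact _ [A [_ [f [fbij fcont [g fK gcont]]]]]]].
pose p (x : E) := unorm (f x).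
have sp : seminorm p.
  have su : seminorm (@unorm R K) := unorm_seminorm Kcompact.
  split=> [x y|a x].
    by apply: le_trans (su.1 (f x) (f y)); rewrite -(linearD f).
  by rewrite -[RHS]su.2 -(linearZZ f).
have fk_cont k : continuous (fun x : E => val (f x) k : R^o).
  apply: (@weak_continuous_continuous _ _ R^o (fun x => val (f x) k)) => x.
  have := (@cvg_Cp R K (f @ nbhs (x : weak E)) (f x) _).1 _ k; apply.
  exact: fcont.
have p_closed : closed [set x | p x <= 1].
  have -> : [set x | p x <= 1] =
      \bigcap_(k in [set: K]) [set x : E | `|val (f x) k : R^o| <= 1].
    apply/seteqP; split=> x /= px; last by apply: unorm_le => // k; exact: px.
    by move=> k _ /=; apply: le_trans (unorm_ge Kcompact _ _) px.
  apply: closed_bigI => k _.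
  apply: (@closed_comp _ _ (fun x : E => `|val (f x) k : R^o|) [set t | t <= 1]).
    by move=> x _; exact: cvg_norm (fk_cont k x).
  exact: closed_le.
have p_cont := closed_seminorm_continuous hE sp p_closed.
have fA x : A (f x) by case: fbij => fA _ _; exact: fA.
have A0 : A 0 by rewrite -(linear0 f).
have dual_bounded (phi : dual E) : exists M, forall x, p x <= 1 -> `|sval phi x| <= M.
  have gphi0 : nbhs (0 : Cp R K) [set h | A h -> `|sval phi (g h)| < 1].
    have : within A (nbhs (0 : Cp R K)) [set h | `|sval phi (g h)| < 1].
      have g0 := (subspace_continuousP A g).1 gcont 0 A0.
      have := cvg_comp _ _ g0 (@dual_weak_continuous R E phi (g 0)).
      move=> /cvgrPdist_lt/(_ _ ltr01).
      apply: filterS => h /=.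
      have -> : g 0 = 0 by rewrite -(linear0 f) fK.
      by rewrite (linear0 (sval phi)) sub0r normrN.
    by [].
  have [d d0 dV] := Cp_nbhs0_unorm Kcompact gphi0.
  exists d^-1 => x px.
  have le_d : unorm (f (d *: x)) <= d.
    by rewrite -/(p (d *: x)) sp.2 gtr0_norm// -[leRHS]mulr1 ler_pM2l.
  have := dV _ le_d (fA _); rewrite fK (linearZZ (sval phi)) normrM gtr0_norm//.
  by move=> lt1; rewrite -(ler_pM2l d0) divff ?gt_eqF// ltW.
(* Functionals dominated by the gauge [q] of a neighbourhood are continuous, so
   bounded on the unit ball of [p]; hence [q] is bounded there too. *)
have p_nbhs (V : set E) : nbhs 0 V -> exists2 e, 0 < e & forall x, p x < e -> V x.
  move=> /seminorm_basis[q [sq q1 qV]].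
  have [|M qM] := @uniform_boundedness R E q [set x | p x <= 1] sq.
    move=> phi phi_q.
    have phi_cont : continuous phi.
      apply: (nbhs0_bounded_linear_continuous (M := 2) q1) => x qx.
      by apply: le_trans (phi_q x) _; rewrite /= in qx; lra.
    exact: (dual_bounded (exist _ phi phi_cont)).
  have M0 : 0 <= M.
    have q0 : q 0 <= M by apply: qM; rewrite /= (sublinear0 (seminorm_sublinear sp)).
    exact: le_trans (seminorm_ge0 _ sq) q0.
  exists (M + 1)^-1 => [|x lt_p]; first by rewrite invr_gt0; lra.
  apply: qV; have : q ((M + 1) *: x) <= M.
    apply: qM; rewrite /= sp.2 gtr0_norm; last by lra.
    by rewrite -ler_pdivlMl ?mulr1 ?ltW//; lra.
  rewrite sq.2 gtr0_norm; last by lra.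
  move=> le_q; rewrite ltNge; apply/negP => q_ge1.
  have := ler_wpM2l (_ : 0 <= M + 1) q_ge1; rewrite mulr1.
  by move=> /(_ ltac:(lra)); lra.
have nbhsE (x : E) : nbhs x = nbhs_ball_ (norm_ball p) x.
  apply/seteqP; split=> V.
    move=> /nbhs_translated/p_nbhs[e e0 eV]; exists e => // y /= xy.
    by have := eV (y - x); rewrite /= addrCA subrr addr0; apply; rewrite seminormB.
  move=> [e /= e0 eV]; apply/nbhs_translated; apply: filterS (p_cont e e0) => y /= py.
  by apply: eV; rewrite /norm_ball/= opprD addrA subrr sub0r seminormN.
exists p; split=> //.
- move=> x px; rewrite -(fK x) -[RHS](fK 0) linear0; congr g.
  apply: val_inj; apply/funext => k /=.
  apply/eqP; rewrite -normr_eq0 eq_le normr_ge0 andbT -px.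
  exact: unorm_ge.
- exact: sp.1.
- exact: sp.2.
- exact: completely_metrizable_norm_complete.
Qed.

End EberleinGrothendieckNorm.

(** * The dual unit ball *)
Section SetType.
Context {X : topologicalType} (A : set X).

Lemma set_val_continuous : continuous (set_val : A -> X).
Proof. exact: initial_continuous. Qed.

Lemma compact_set_type : compact A -> compact [set: A].
Proof.
move=> cA F FF _.
have [|x [Ax clx]] := cA (set_val @ F) _.
  by apply: (@filterE _ F) => a; exact: set_valP.
exists (exist _ x (mem_set Ax)); split=> // B C FB [_ [[U oU <-] Ux] UC].
have [||_ [[b Bb <-] Ub]] := clx (set_val @` B) U.
- by apply: (@filterS _ F _ B) => [b Bb|]; [exists b|].
- exact: open_nbhs_nbhs.
by exists b; split=> //; exact: UC.
Qed.

Lemma hausdorff_set_type : hausdorff_space X -> hausdorff_space A.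
Proof.
move=> hX a b ab; apply: val_inj; apply: hX => U V Ua Vb.
have [c [Uc Vc]] := ab _ _ (set_val_continuous Ua) (set_val_continuous Vb).
by exists (set_val c).
Qed.

End SetType.

Section DualBall.
Context {R : realType} {E : tvsType R} (N : E -> R).

Definition dual_ball : set {ptws E -> R^o} := [set phi |
  [/\ forall x y, phi (x + y) = phi x + phi y,
      forall a x, phi (a *: x) = a * phi x &
      forall x, `|phi x| <= N x]].

Lemma eval_continuous x : continuous (fun phi : {ptws E -> R^o} => phi x : R^o).
Proof.
move=> phi.
have : nbhs (phi : {ptws E -> R^o}) --> (phi : {ptws E -> R^o}) by exact: cvg_id.
by move=> /pointwise_cvgP/(_ x).
Qed.

(** The Banach-Alaoglu theorem: linearity is a closed condition on the compact
    product of the intervals [[- N x, N x]]. *)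
Lemma dual_ball_compact : compact dual_ball.
Proof.
have -> : dual_ball =
  (\bigcap_(z in [set: E * E]) [set phi | phi (z.1 + z.2) - (phi z.1 + phi z.2) = 0] `&`
  \bigcap_(z in [set: R * E]) [set phi | phi (z.1 *: z.2) - z.1 * phi z.2 = 0]) `&`
  [set phi : {ptws E -> R^o} | forall x, `[- N x, N x]%classic (phi x)].
  apply/seteqP; split=> phi.
    move=> [phiD phiZ phiN]; split; [split=> -[a x] _ /=|move=> x] => /=.
    - by rewrite phiD subrr.
    - by rewrite phiZ subrr.
    - by rewrite in_itv/= -ler_norml.
  move=> [[phiD phiZ] phiN]; split=> [x y|a x|x].
  - by apply/eqP; rewrite -subr_eq0; apply/eqP; exact: (phiD (x, y)).
  - by apply/eqP; rewrite -subr_eq0; apply/eqP; exact: (phiZ (a, x)).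
  - by have := phiN x; rewrite /= in_itv/= -ler_norml.
rewrite setIC; apply: compact_closedI.
  by apply: (@tychonoff E (fun=> R^o) (fun x => `[- N x, N x]%classic)) => x;
    exact: segment_compact.
have closed_eq0 (h : {ptws E -> R^o} -> R^o) :
    continuous h -> closed [set phi | h phi = 0].
  by move=> hc; apply: (@closed_comp _ _ h [set 0]) => //; exact: closed_eq.
apply: closedI; apply: closed_bigI => -[a x] _ /=; apply: closed_eq0 => phi.
  exact: (cvgB (@eval_continuous (a + x) phi)
    (cvgD (@eval_continuous a phi) (@eval_continuous x phi))).
exact: (cvgB (@eval_continuous (a *: x) phi)
  (cvgZr (V := R^o) (k := a) (@eval_continuous x phi))).
Qed.

Lemma evaluation_in (x : E) :
  ((fun phi : dual_ball => set_val phi x) : {ptws dual_ball -> R^o})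
    \in @continuous_fun R dual_ball.
Proof.
apply/asboolP => phi.
exact: cvg_comp (@set_val_continuous _ dual_ball phi)
  (@eval_continuous x (set_val phi)).
Qed.

Definition evaluation (x : weak E) : Cp R dual_ball :=
  exist (fun h => h \in @continuous_fun R dual_ball) _ (evaluation_in x).

Lemma evaluation_linear : linear evaluation.
Proof.
move=> a x y; apply: val_inj; apply/funext => phi /=.
have [phiD phiZ _] := set_valP phi.
by apply: etrans (phiD _ _) _; congr (_ + _); exact: phiZ.
Qed.

HB.instance Definition _ := GRing.isLinear.Build R (weak E) (Cp R dual_ball) *:%R
  evaluation evaluation_linear.

End DualBall.

(** * Normed spaces in their weak topology *)
Section NormedSpaces.
Context {R : realType} {E : tvsType R}.

Lemma continuous_linear_le_norm (N : E -> R) (phi : {linear E -> R^o}) : seminorm N ->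
  (forall x : E, nbhs x = nbhs_ball_ (norm_ball N) x) -> continuous phi ->
  exists2 c, 0 < c & forall x, `|phi x| <= c * N x.
Proof.
move=> sN nbhsE phi_cont.
have : nbhs (0 : E) [set x | `|phi x| < 1].
  have /cvgrPdist_lt/(_ 1 ltr01) := phi_cont 0; rewrite linear0.
  by apply: filterS => x; rewrite sub0r normrN.
rewrite nbhsE => -[e /= e0 eP].
exists (2 / e); first exact: divr_gt0.
move=> x; apply/ler_addgt0Pr => d d0.
have Nd0 : 0 < 2 / e * N x + d.
  by apply: ltr_wpDl => //; rewrite mulr_ge0 ?divr_ge0 ?(seminorm_ge0 _ sN)// ltW.
have := eP ((2 / e * N x + d)^-1 *: x); rewrite /norm_ball /= sub0r seminormN//.
rewrite sN.2 linearZZ normrM gtr0_norm ?invr_gt0// !ltr_pdivrMl// mulr1.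
move=> le_phi; apply/ltW/le_phi.
rewrite (_ : (2 / e * N x + d) * e = 2 * N x + d * e); last by field; lra.
by have := seminorm_ge0 x sN; have := mulr_gt0 d0 e0; lra.
Qed.

(** The evaluation embedding in the continuous functions on the dual unit
    ball. A functional [phi] with [|phi| <= c N] is [c] times a point of the
    ball, so on the range of the embedding [phi] is the pointwise continuous map
    [h |-> c * h (phi / c)]. *)
Lemma normed_EG : generated_by_complete_norm E -> linearly_Eberlein_Grothendieck (weak E).
Proof.
move=> [N [N0 ND NZ nbhsE _]].
have sN : seminorm N by [].
pose K := dual_ball N; pose f : {linear weak E -> Cp R K} := @evaluation R E N.
have in_K (phi : {linear E -> R^o}) : (forall x, `|phi x| <= N x) ->
    (phi : {ptws E -> R^o}) \in K.
  by move=> phiN; apply/mem_set; split=> // [x y|a x]; rewrite ?linearD ?linearZZ.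
pose pt (phi : {ptws E -> R^o}) (phiK : phi \in K) : K := exist _ phi phiK.
have f_inj (x y : E) : f x = f y -> x = y.
  move=> fxy; apply/eqP; rewrite -subr_eq0; apply/eqP/N0.
  have [phi [le_phi phixy]] := hahn_banach (x - y) (seminorm_sublinear sN).
  have phiN z : `|phi z| <= N z by exact: seminorm_ler_norm.
  have /(congr1 (fun h : Cp R K => val h (pt _ (in_K phi phiN)))) := fxy.
  move=> phi_eq; rewrite -phixy linearB; apply/eqP; rewrite subr_eq0.
  exact/eqP.
pose g (h : Cp R K) : weak E := xget 0 [set x | f x = h].
have fK : cancel f g.
  by move=> x; apply: f_inj; rewrite /g; case: xgetP => [y _|/(_ x)/(_ erefl)].
exists K; split.
- exact/compact_set_type/dual_ball_compact.
- apply/hausdorff_set_type/hausdorff_product => x; exact: norm_hausdorff.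
exists (range f); split.
  split; first by rewrite inE; exists 0 => //; rewrite linear0.
  move=> a _ _ /set_mem[x _ <-] /set_mem[y _ <-]; rewrite inE.
  by exists (a *: x + y) => //; rewrite linearP.
exists f; split.
- split=> [x _|x y _ _|h [x _ <-]]; [by exists x|exact: f_inj|by exists x].
- move=> x; apply: (@cvg_Cp R K (f @ nbhs (x : weak E)) (f x) _).2 => k.
  have [kD kZ kN] := set_valP k.
  have k_lin : linear (set_val k : E -> R^o).
    by move=> a y z; apply: etrans (kD _ _) _; congr (_ + _); exact: kZ.
  pose L := GRing.isLinear.Build _ _ _ _ (set_val k : E -> R^o) k_lin.
  pose phi : {linear E -> R^o} := HB.pack (set_val k : E -> R^o) L.
  have phi_cont : continuous phi.
    apply: (nbhs0_bounded_linear_continuous (M := 1) (V := norm_ball N 0 1)).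
      by rewrite nbhsE; exists 1 => /=.
    move=> y; rewrite /norm_ball /= sub0r seminormN// => /ltW; apply: le_trans.
    exact: kN.
  exact: (@dual_weak_continuous R E (exist _ phi phi_cont) x).
exists g => //; apply/subspace_continuousP => h [x _ <-].
suff: g @ within (range f) (nbhs (f x)) --> g (f x) by [].
rewrite fK; apply/cvg_weak => phi.
have [c c0 phi_le] := continuous_linear_le_norm sN nbhsE (svalP phi).
pose k : E -> R^o := fun y => c^-1 * sval phi y.
have kK : (k : {ptws E -> R^o}) \in K.
  apply/mem_set; rewrite /k; split=> [y z|a y|y]; rewrite ?linearD ?linearZZ ?mulrDr//.
    exact: mulrCA.
  by rewrite normrM gtr0_norm ?invr_gt0// ler_pdivrMl.
have phi_eval y : sval phi y = c * val (f y) (pt k kK).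
  by rewrite [RHS]mulrA divff ?mul1r ?gt_eqF.
apply/cvgrPdist_lt => e e0; rewrite /within /=.
have /cvg_Cp/(_ (pt k kK))/cvgrPdist_lt/(_ _ (divr_gt0 e0 c0)) :
  nbhs (f x) --> f x by exact: cvg_id.
apply: filterS => h' lt_e [y _ fy]; move: lt_e; rewrite -fy => lt_e /=.
rewrite -/f [g _](fK y) !phi_eval -mulrBr normrM.
by rewrite gtr0_norm// mulrC -ltr_pdivlMr.
Qed.

End NormedSpaces.

(** * Complete norms and Banach spaces *)

(** A copy of [E] on which the norm [N], rather than the structure of [E],
    determines the topology; the proofs are parameters so that the instances
    below can be found from the type. *)
Definition renormed (R : realType) (E : tvsType R) (N : E -> R) (sN : seminorm N)
  (N0 : forall x, N x = 0 -> x = 0) : Type := E.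

Section Renormed.
Context {R : realType} {E : tvsType R} {N : E -> R} (sN : seminorm N).
Context (N0 : forall x, N x = 0 -> x = 0).

HB.instance Definition _ := GRing.Lmodule.on (renormed sN N0).
HB.instance Definition _ := Lmodule_isNormed.Build R (renormed sN N0)
  sN.1 sN.2 N0.

End Renormed.

Section Banach.
Context {R : realType} {E : tvsType R}.

Lemma complete_norm_isomorphic_Banach : generated_by_complete_norm E ->
  exists B : completeNormedModType R, isomorphic E B.
Proof.
move=> [N [N0 ND NZ nbhsE complete]].
pose sN : seminorm N := conj ND NZ; pose B0 := renormed sN N0.
have nbhsB (x : B0) : nbhs x = nbhs (x : E).
  by rewrite nbhsE; apply/funext => A; apply/propext; exact: (@nbhs_ballP R B0 x A).
have B0_complete (F : set_system B0) : ProperFilter F -> cauchy F -> cvg F.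
  move=> FF /cauchyP Fc; have [|x Fx] := complete F FF.
    by move=> e e0; have [x Fx] := Fc e e0; exists x.
  by apply/cvg_ex; exists x => A; rewrite nbhsB; exact: Fx.
pose B : completeNormedModType R :=
  HB.pack B0 (Uniform_isComplete.Build B0 B0_complete).
have id_lin : linear (fun x : E => x : B) by [].
pose L := GRing.isLinear.Build R E B *:%R (fun x : E => x : B) id_lin.
pose f : {linear E -> B} := HB.pack (fun x : E => x : B) L.
exists B, f; split.
- by split=> // x _; exists x.
- by move=> x A Ax; have : nbhs (x : B0) A by []; rewrite nbhsB.
- exists (fun x : B => x : E) => //; apply: continuous_subspaceT.
  by move=> x A Ax; suff: nbhs (x : B0) A by []; rewrite nbhsB.
Qed.

Lemma isomorphic_Banach_complete_norm (B : completeNormedModType R) :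
  isomorphic E B -> generated_by_complete_norm E.
Proof.
move=> [f [[_ f_inj f_surj] f_cont [g fK g_within]]].
have g_cont : continuous g by exact/(continuous_subspace_setT g).2.
exists (fun x => `|f x|); split.
- by move=> x /eqP; rewrite normr_eq0 => /eqP fx; rewrite -(fK x) fx -(linear0 f) fK.
- by move=> x y; rewrite linearD ler_normD.
- by move=> a x; rewrite linearZZ normrZ.
- move=> x; apply/seteqP; split=> A.
    move=> Ax; have := g_cont (f x) A; rewrite fK => /(_ Ax)/nbhs_ballP[e /= e0 eA].
    exists e => // y; rewrite /norm_ball /= linearB => xy.
    by have := eA (f y); rewrite /= fK; apply; rewrite -ball_normE.
  move=> [e /= e0 eA]; have : nbhs (f x) (ball (f x) e) by exact: nbhsx_ballx.
  move=> /f_cont; apply: (@filterS _ (nbhs x)) => y.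
  by rewrite /= -ball_normE /= -linearB; exact: eA.
- move=> F FF Fc; have : cauchy (f @ F).
    apply: cauchy_exP => e e0; have [x Fx] := Fc e e0; exists (f x).
    apply: (@filterS _ F _ (norm_ball (fun x => `|f x|) x e)) => [y|//].
    by rewrite /norm_ball /= -ball_normE /= linearB.
  move=> /cauchy_cvg/cvg_ex[b fFb]; exists (g b) => A /g_cont/fFb.
  by apply: (@filterS _ F) => x /=; rewrite fK.
Qed.

End Banach.

Theorem proposition3p8 (R : realType) (E : tvsType R) (hE : frechet_space E) :
  (linearly_Eberlein_Grothendieck (weak E) <-> generated_by_complete_norm E) /\
  (generated_by_complete_norm E <->
     exists B : completeNormedModType R, isomorphic E B).
Proof.
split; split.
- exact: EG_norm.
- exact: normed_EG.
- exact: complete_norm_isomorphic_Banach.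
- by move=> [B]; exact: isomorphic_Banach_complete_norm.
Qed.
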